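(* Let $k\geq 2$ be an integer and let $\mathcal{C}_k\subset\mathbb{P}^2_{\mathbb{C}}$ be the curve (an arrangement of $k$ smooth conics) defined by $$f_k=x^{k}y^{k}+z^{2k}=0.$$ Then $\mathcal{C}_k$ is nearly free with exponents $(1,2k-1)$.
   Context: Let $S=\mathbb{C}[x,y,z]$ with its standard grading and let $\mathfrak{m}=\langle x,y,z\rangle$. For a reduced plane curve $C\subset\mathbb{P}^2_{\mathbb{C}}$ of degree $d$ given by $f=0$, with $f\in S$ homogeneous, let $J_f=\langle \partial_x f,\partial_y f,\partial_z f\rangle$ be the Jacobian ideal, $I_f$ the saturation of $J_f$ with respect to $\mathfrak{m}$, $N(f)=I_f/J_f$ (a graded $S$-module), and $M(f)=S/J_f$ the Milnor algebra. The curve $C$ is called nearly free if $N(f)\neq 0$ and $\dim_{\mathbb{C}} N(f)_j\leq 1$ for every $j$. If $C$ is nearly free, the minimal graded free resolution of $M(f)$ has the form $$0\to S(-b-2(d-1))\to S(-d_1-(d-1))\oplus S(-d_2-(d-1))\oplus S(-d_3-(d-1))\to S^3(-d+1)\to S$$ for integers $d_1\le d_2\le d_3$ and $b$ with $d_1+d_2=d$, $d_2=d_3$ and $b=d_2-d+2$. The pair $(d_1,d_2)$ is called the exponents of the nearly free curve $C$. *)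

(* Defs.v *)
From mathcomp Require Import all_boot all_order all_algebra.
From mathcomp Require Import reals complex mpoly.

Set Implicit Arguments.
Unset Strict Implicit.
Unset Printing Implicit Defensive.

Import Order.TTheory GRing.Theory Num.Theory.
Local Open Scope ring_scope.

(* Ideals of a commutative ring, as membership predicates. *)

Definition ideal_gen (A : comNzRingType) (r : nat) (g : 'I_r -> A) (p : A) : Prop :=
  exists a : 'I_r -> A, p = \sum_(i < r) a i * g i.

Definition ideal_prod (A : comNzRingType) (I J : A -> Prop) (p : A) : Prop :=
  exists (r : nat) (a b : 'I_r -> A),
    [/\ forall i, I (a i), forall i, J (b i) & p = \sum_(i < r) a i * b i].

Definition ideal_pow (A : comNzRingType) (I : A -> Prop) (s : nat) : A -> Prop :=
  iter s (ideal_prod I) (fun=> True).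

(* J : I^oo, the union over s of the colon ideals J : I^s *)
Definition saturation (A : comNzRingType) (J I : A -> Prop) (p : A) : Prop :=
  exists s : nat, forall h, ideal_pow I s h -> J (h * p).

Definition max_ideal (K : fieldType) (n : nat) : {mpoly K[n]} -> Prop :=
  ideal_gen (fun i : 'I_n => 'X_i).

Definition jacobian_ideal (K : fieldType) (n : nat) (f : {mpoly K[n]}) :
    {mpoly K[n]} -> Prop :=
  ideal_gen (fun i : 'I_n => f^`M(i)).

Definition sat_jacobian_ideal (K : fieldType) (n : nat) (f : {mpoly K[n]}) :
    {mpoly K[n]} -> Prop :=
  saturation (jacobian_ideal f) (@max_ideal K n).

(* For homogeneous ideals J included in I, the graded piece (I / J)_j is
   I_j / J_j; its K-dimension is s when it has a basis consisting of the classes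
   of s elements v_0, ..., v_(s-1) of I_j. *)
Definition quot_piece_dim (K : fieldType) (n : nat) (I J : {mpoly K[n]} -> Prop)
    (j s : nat) : Prop :=
  exists v : 'I_s -> {mpoly K[n]},
    (forall i, I (v i) /\ v i \is j.-homog) /\
    (forall p, I p -> p \is j.-homog ->
       exists! c : 'rV[K]_s, J (p - \sum_(i < s) c 0 i *: v i)).

(* f = 0 is a reduced plane curve of degree d; reducedness says that f has no
   repeated nonconstant factor. *)
Definition reduced_plane_curve (K : fieldType) (d : nat) (f : {mpoly K[3]}) : Prop :=
  [/\ (0 < d)%N, f != 0, f \is d.-homog &
      forall g h : {mpoly K[3]}, f = g ^+ 2 * h -> g \is a GRing.unit].

(* N(f) = I_f / J_f is concentrated in nonnegative degrees. *)
Definition nearly_free (K : fieldType) (d : nat) (f : {mpoly K[3]}) : Prop :=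
  [/\ reduced_plane_curve d f,
      exists p, sat_jacobian_ideal f p /\ ~ jacobian_ideal f p &
      forall j : nat, exists2 s : nat, (s <= 1)%N &
        quot_piece_dim (sat_jacobian_ideal f) (jacobian_ideal f) j s].

(* p lies in the graded piece S_a, which is 0 for a < 0 *)
Definition zhomog (K : fieldType) (n : nat) (a : int) (p : {mpoly K[n]}) : Prop :=
  match a with
  | Posz d => p \is d.-homog
  | Negz _ => p = 0
  end.

(* A sequence of integers s encodes the graded free module \bigoplus_j S(-s_j),
   whose elements are row vectors. Matrices act on the right, so a graded map of
   degree 0 from \bigoplus_i S(-s_i) to \bigoplus_j S(-t_j) is a matrix whose
   (i, j) entry is homogeneous of degree s_i - t_j. *)
Definition graded_map (K : fieldType) (n : nat) (s t : seq int)
    (D : 'M[{mpoly K[n]}]_(size s, size t)) : Prop :=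
  forall (i : 'I_(size s)) (j : 'I_(size t)), zhomog (s`_i - t`_j) (D i j).

(* ... -> F_1 -> F_0 -> S/J -> 0 with F_i = \bigoplus_j S(-(a i)_j), where D i is
   the map F_(i+1) -> F_i and the augmentation F_0 -> S/J is represented by a
   graded map e : F_0 -> S. *)
Record minimal_graded_free_resolution (K : fieldType) (n : nat)
    (J : {mpoly K[n]} -> Prop) (a : nat -> seq int)
    (D : forall i, 'M[{mpoly K[n]}]_(size (a i.+1), size (a i)))
    (e : 'M[{mpoly K[n]}]_(size (a 0%N), size [:: 0 : int])) : Prop := {
  res_graded : forall i, graded_map (D i);
  aug_graded : graded_map e;
  aug_surj : forall p, exists v : 'rV_(size (a 0%N)), J (p - (v *m e) 0 0);
  aug_exact : forall v : 'rV_(size (a 0%N)),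
    J ((v *m e) 0 0) <-> exists w, v = w *m D 0%N;
  res_exact : forall i (v : 'rV_(size (a i.+1))),
    v *m D i = 0 <-> exists w, v = w *m D i.+1;
  res_minimal : forall i k l, max_ideal (D i k l)
}.

Definition nearly_free_shifts (d d1 d2 d3 b : int) (i : nat) : seq int :=
  match i with
  | 0 => [:: 0]
  | 1 => nseq 3 (d - 1)
  | 2 => [:: d1 + (d - 1); d2 + (d - 1); d3 + (d - 1)]
  | 3 => [:: b + 2 * (d - 1)]
  | _ => [::]
  end.

Definition has_exponents (K : fieldType) (d : nat) (f : {mpoly K[3]}) (d1 d2 : int) :
    Prop :=
  exists d3 b : int,
    [/\ (d1 <= d2) && (d2 <= d3), d1 + d2 = d%:Z, d2 = d3, b = d2 - d%:Z + 2 &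
      exists D e, @minimal_graded_free_resolution K 3 (jacobian_ideal f)
        (nearly_free_shifts d%:Z d1 d2 d3 b) D e].

Definition conic_arrangement (K : fieldType) (k : nat) : {mpoly K[3]} :=
  let x := 'X_0 in let y := 'X_1 in let z := 'X_(2%:R) in
  x ^+ k * y ^+ k + z ^+ (2 * k).

(* Main.v *)
Require Import Defs.
From mathcomp Require Import all_boot all_order all_algebra.
From mathcomp Require Import reals complex mpoly.
From mathcomp Require Import zify ring.

(** Write u = (xy)^(k-1) and Z = z^(2k-1).  Up to nonzero scalars, the partial
    derivatives of f = x^k y^k + z^(2k) are uy, ux and Z, so the Jacobian ideal
    J is a monomial ideal, and questions about J reduce to inequalities between
    exponents: p lies in J exactly when each monomial of p does
    ([ideal_gen_monomialP], [jacobianP]).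

    Multiplying by large powers of x and of y shows that the saturation of J is
    the monomial ideal (u, Z) ([saturationP]).  The monomials of (u, Z) that are
    not in J are the u z^i with i < 2k-1, and these have pairwise distinct
    degrees ([gap_mon]); hence N(f) is nonzero with graded pieces of dimension
    at most 1.  The curve is reduced because a factor g with g^2 | f divides
    both uy and Z, so its leading monomial divides two coprime monomials and g
    is constant.

    The resolution is explicit.  The syzygies of (uy, ux, 2Z) are generated by
    (x, -y, 0), of degree 1, and by (2Z, 0, -uy) and (0, 2Z, -ux), of degree
    2k-1; the only relation between these is (2Z, -x, y).  Exactness rests on
    one fact, used repeatedly: a relation p M = q M' between coprime monomials M
    and M' is a multiple of the obvious one ([coprime_monomial_syzygy]).

    Characteristic 0 enters through the scalars k and 2k, which have to be
    invertible for the partial derivatives to be monomials up to units. *)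

Set Implicit Arguments.
Unset Strict Implicit.
Unset Printing Implicit Defensive.

Import Order.TTheory GRing.Theory Num.Theory.
Local Open Scope ring_scope.

(** * Monomial ideals *)

Section Support.
Variables (K : fieldType) (n : nat).
Implicit Types (p q : {mpoly K[n]}) (m : 'X_{1..n}) (P : pred 'X_{1..n}).

Lemma all_msuppD P p q :
  all P (msupp p) -> all P (msupp q) -> all P (msupp (p + q)).
Proof.
move=> /allP hp /allP hq; apply/allP => m /msuppD_le.
by rewrite mem_cat => /orP[/hp|/hq].
Qed.

Lemma all_msupp_sum P (I : Type) (r : seq I) (F : I -> {mpoly K[n]}) :
  (forall i, all P (msupp (F i))) -> all P (msupp (\sum_(i <- r) F i)).
Proof.
move=> hF; apply: (big_ind (fun p => all P (msupp p))) => //.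
- by rewrite msupp0.
- by move=> p q; apply: all_msuppD.
Qed.

(** Cancellations are harmless: the support of a product is contained in the set
    of sums of exponents of its factors. *)
Lemma all_msuppM P (Q1 Q2 : pred 'X_{1..n}) p q :
  (forall m1 m2, Q1 m1 -> Q2 m2 -> P (m1 + m2)%MM) ->
  all Q1 (msupp p) -> all Q2 (msupp q) -> all P (msupp (p * q)).
Proof.
move=> PD /allP hp /allP hq; apply/allP => m /msuppM_le /allpairsP[[m1 m2]] /=.
by case=> m1p m2q ->; apply: PD; [apply: hp | apply: hq].
Qed.

Lemma all_msuppMX P p m :
  all P (msupp (p * 'X_[m])) = all (fun m' => P (m + m')%MM) (msupp p).
Proof. by rewrite (perm_all _ (msuppMX p m)) all_map. Qed.

(** An ideal generated by monomials is spanned by the monomials it contains.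
    The nonzero coefficients [c] allow the generators to be partial derivatives
    of sums of powers. *)
Lemma ideal_gen_monomialP r (g : 'I_r -> {mpoly K[n]}) (c : 'I_r -> K)
    (m : 'I_r -> 'X_{1..n}) p :
  (forall i, g i = c i *: 'X_[m i]) -> (forall i, c i != 0) ->
  ideal_gen g p <->
  all (fun m' => [exists i, (m i <= m')%MM]) (msupp p).
Proof.
move=> gE c0; split.
  case=> a ->; apply: all_msupp_sum => i.
  rewrite gE -scalerAr scalerAl all_msuppMX; apply/allP => m' _.
  by apply/existsP; exists i; rewrite lem_addr.
move=> /allP hp; rewrite [p]mpolyE big_seq.
apply: (big_ind (ideal_gen g)).
- by exists (fun=> 0); rewrite big1 // => i _; rewrite mul0r.
- move=> _ _ [a ->] [b ->]; exists (fun i => a i + b i).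
  by rewrite -big_split; apply: eq_bigr => i _; rewrite mulrDl.
move=> m' /hp /existsP[i le_m].
exists (fun j => if j == i then ((c i)^-1 * p@_m') *: 'X_[m' - m i] else 0).
rewrite (bigD1 i) //= eqxx big1 => [|j /negPf->]; last by rewrite mul0r.
rewrite addr0 gE -scalerAl -scalerAr scalerA -mpolyXD submK //.
by rewrite mulrAC mulVf ?mul1r.
Qed.

(** Divisibility by a monomial is the case of a single generator. *)
Lemma monomial_dvdP m p :
  all (fun m' => (m <= m')%MM) (msupp p) -> exists q, p = q * 'X_[m].
Proof.
move=> hp.
have [|_ []] := @ideal_gen_monomialP 1 (fun=> 'X_[m]) (fun=> 1) (fun=> m) p _
  (fun=> oner_neq0 K); first by move=> i; rewrite scale1r.
  apply/allP => m' /(allP hp) le_m.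
  by apply/existsP; exists ord0.
by move=> a ->; exists (a ord0); rewrite big_ord1.
Qed.

(** The Koszul relation generates the syzygies of two coprime monomials: every
    monomial of [p] times ['X_[u]] is a multiple of ['X_[v]], and [u] does not
    contribute to the exponents in the support of [v]. *)
Lemma coprime_monomial_syzygy (u v : 'X_{1..n}) p q :
  (forall i, (u i == 0%N) || (v i == 0%N)) -> p * 'X_[u] = q * 'X_[v] ->
  exists t, p = t * 'X_[v] /\ q = t * 'X_[u].
Proof.
move=> uv pq; have Xn0 w : 'X_[w] != 0 :> {mpoly K[n]}.
  by rewrite -msupp_eq0 msuppX.
have /monomial_dvdP[t tE] : all (fun m' => (v <= m')%MM) (msupp p).
  have : all (fun m' => (v <= m')%MM) (msupp (p * 'X_[u])).
    by rewrite pq all_msuppMX; apply/allP => m' _; rewrite lem_addr.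
  rewrite all_msuppMX; apply: sub_all => m' /mnm_lepP le_v.
  apply/mnm_lepP => i; have := le_v i; rewrite mnmDE.
  by case/orP: (uv i) => /eqP->.
exists t; split=> //; apply: (mulIf (Xn0 v)).
by rewrite -pq tE mulrAC.
Qed.

Lemma mlead_dvd_monomial (c : K) m p q :
  c != 0 -> p * q = c *: 'X_[m] -> (mlead p <= m)%MM.
Proof.
move=> c0 pq; have : p * q != 0 by rewrite pq -msupp_eq0 msuppMCX.
rewrite mulf_eq0 negb_or => /andP[p0 q0].
have <- : mlead (p * q) = m by rewrite pq mleadZ ?mleadXm.
by rewrite mleadM // lem_addr.
Qed.

Lemma max_idealP p : max_ideal p <-> all (fun m => (0 < mdeg m)%N) (msupp p).
Proof.
rewrite /max_ideal (@ideal_gen_monomialP _ _ (fun=> 1) (fun i => U_(i)%MM)).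
- suff E : (fun m => [exists i, (U_(i) <= m)%MM]) =1 (fun m => (0 < mdeg m)%N).
    by rewrite (eq_all E).
  move=> m; rewrite lt0n mdeg_eq0; apply/existsP/idP.
    by case=> i; rewrite lep1mP; apply: contraNneq => ->; rewrite mnm0E.
  move=> m0; apply/existsP; apply: contraNT m0 => /existsPn h.
  by apply/eqP/mnmP => i; move: (h i); rewrite lep1mP negbK mnm0E => /eqP.
- by move=> i; rewrite scale1r.
- by move=> i; apply: oner_neq0.
Qed.

Lemma max_ideal_powP s p :
  ideal_pow (@max_ideal K n) s p -> all (fun m => (s <= mdeg m)%N) (msupp p).
Proof.
elim: s p => [|s IHs] p; first by move=> _; apply/allP.
case=> r [a [b [ha hb ->]]]; apply: all_msupp_sum => i.
apply: (all_msuppM _ (iffLR (max_idealP _) (ha i)) (IHs _ (hb i))).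
by move=> m1 m2 h1 h2; rewrite mdegD -add1n leq_add.
Qed.

Lemma expX_max_ideal_pow s i : ideal_pow (@max_ideal K n) s ('X_i ^+ s).
Proof.
elim: s => [|s IHs] //.
exists 1%N, (fun=> 'X_i), (fun=> 'X_i ^+ s); split=> //.
  move=> _; apply/max_idealP; by rewrite msuppX /= mdeg1.
by rewrite big_ord1 exprS.
Qed.

Lemma zhomog0 a : zhomog a (0 : {mpoly K[n]}).
Proof. by case: a => d //=; apply: dhomog0. Qed.

(** A graded map all of whose entries have positive degree is minimal. *)
Lemma zhomog_max_ideal a p : 0 < a -> zhomog a p -> max_ideal p.
Proof.
case: a => // d d0 /dhomogP hp; apply/max_idealP/allP => m /hp /= ->.
exact: d0.
Qed.

End Support.

(** * Exponents in three variables *)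

Definition xyz (a b c : nat) : 'X_{1..3} := [multinom nth 0%N [:: a; b; c] i | i < 3].

Lemma xyzE a b c :
  (xyz a b c 0 = a) * (xyz a b c 1 = b) * (xyz a b c 2%:R = c).
Proof. by rewrite !mnmE. Qed.

Lemma ord3P (P : 'I_3 -> Prop) : P 0 -> P 1 -> P 2%:R -> forall i, P i.
Proof.
move=> P0 P1 P2 i; have : [|| i == 0, i == 1 | i == 2%:R].
  by case: i => [[|[|[|]]]].
by case/or3P=> /eqP->.
Qed.

Lemma xyz_le a b c m :
  (xyz a b c <= m)%MM = [&& a <= m 0%R, b <= m 1%R & c <= m 2%:R%R]%N.
Proof.
apply/mnm_lepP/and3P => [h|[h0 h1 h2]].
  by move: (h 0) (h 1) (h 2%:R); rewrite !xyzE.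
by apply: ord3P; rewrite xyzE.
Qed.

Lemma xyzD a b c a' b' c' :
  (xyz a b c + xyz a' b' c')%MM = xyz (a + a') (b + b') (c + c').
Proof. by apply/mnmP; apply: ord3P; rewrite mnmDE !xyzE. Qed.

Lemma mdeg3E (m : 'X_{1..3}) : mdeg m = (m 0%R + m 1%R + m 2%:R%R)%N.
Proof.
rewrite mdegE !big_ord_recl big_ord0 addn0 addnA.
by congr addn; [congr addn|]; congr (m _); apply: val_inj.
Qed.

Lemma mdeg_xyz a b c : mdeg (xyz a b c) = (a + b + c)%N.
Proof. by rewrite mdeg3E !xyzE. Qed.

(** * The saturation of the Jacobian ideal, and near freeness *)

Section Conics.
Variables (K : fieldType) (k : nat).
Hypotheses (k_gt1 : (1 < k)%N) (charK : (2 * k)%:R != 0 :> K).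

Local Notation f := (conic_arrangement K k).
Local Notation J := (jacobian_ideal f).
Local Notation I := (sat_jacobian_ideal f).
Local Notation x := ('X_[xyz 1 0 0] : {mpoly K[3]}).
Local Notation y := ('X_[xyz 0 1 0] : {mpoly K[3]}).
Local Notation u := ('X_[xyz k.-1 k.-1 0] : {mpoly K[3]}).
Local Notation Z := ('X_[xyz 0 0 (2 * k).-1] : {mpoly K[3]}).

Definition partial_coef (i : 'I_3) : K := [:: k%:R; k%:R; (2 * k)%:R]`_i.

Definition partial_mon (i : 'I_3) : 'X_{1..3} :=
  nth 0%MM [:: xyz k.-1 k 0; xyz k k.-1 0; xyz 0 0 (2 * k).-1] i.

Lemma k_neq0 : k%:R != 0 :> K.
Proof. by move: charK; rewrite natrM mulf_eq0 negb_or => /andP[]. Qed.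

Lemma two_neq0 : 2%:R != 0 :> K.
Proof. by move: charK; rewrite natrM mulf_eq0 negb_or => /andP[]. Qed.

Lemma partial_coef_neq0 i : partial_coef i != 0.
Proof. by move: i; apply: ord3P; rewrite /partial_coef /= ?k_neq0. Qed.

Lemma conicE : f = 'X_[xyz k k 0] + 'X_[xyz 0 0 (2 * k)].
Proof.
rewrite /conic_arrangement !mpolyXn -mpolyXD.
congr ('X_[_] + 'X_[_]); apply/mnmP; apply: ord3P;
  by rewrite ?mnmDE !mulmnE !mnm1E !xyzE /= ?muln0 ?mul0n ?mul1n ?add0n ?addn0.
Qed.

Lemma partialE i : f^`M(i) = partial_coef i *: 'X_[partial_mon i].
Proof.
have subE a b c j : (xyz a b c - U_(j))%MM =
    xyz (a - (j == 0)) (b - (j == 1)) (c - (j == 2%:R)).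
  by apply/mnmP; apply: ord3P; rewrite mnmBE mnm1E !xyzE.
rewrite conicE mderivD !mderivX !subE.
by move: i; apply: ord3P;
  rewrite !xyzE /partial_coef /partial_mon /= ?scale0r ?addr0 ?add0r ?subn0 ?subn1.
Qed.

(** Membership of a monomial in the ideal (uy, ux, Z). *)
Definition jac_mon (m : 'X_{1..3}) : bool :=
  [|| (k.-1 <= m 0%R) && (k <= m 1%R), (k <= m 0%R) && (k.-1 <= m 1%R)
    | (2 * k).-1 <= m 2%:R%R]%N.

(** Membership of a monomial in the ideal (u, Z). *)
Definition sat_mon (m : 'X_{1..3}) : bool :=
  ((k.-1 <= m 0%R) && (k.-1 <= m 1%R) || ((2 * k).-1 <= m 2%:R%R))%N.

Lemma jacobianP p : J p <-> all jac_mon (msupp p).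
Proof.
rewrite /jacobian_ideal (ideal_gen_monomialP _ partialE partial_coef_neq0).
suff E : (fun m => [exists i, (partial_mon i <= m)%MM]) =1 jac_mon.
  by rewrite (eq_all E).
move=> m; apply/existsP/or3P.
  case=> i; move: i; apply: ord3P; rewrite /partial_mon xyz_le ?andbT => h.
  - by constructor 1.
  - by constructor 2.
  - by constructor 3.
case=> h; [exists 0 | exists 1 | exists 2%:R];
  by rewrite /partial_mon xyz_le ?h ?andbT.
Qed.

(** If [p] is in the saturation, then x^s p and y^s p lie in the monomial ideal
    [J] for some s; a monomial m with both x^s m and y^s m in [J] is divisible by
    u or Z.  Conversely a monomial of degree at least 2k-1 is divisible by x, y or
    Z, and each of these sends (u, Z) into [J]. *)
Lemma saturationP p : I p <-> all sat_mon (msupp p).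
Proof.
split.
  case=> s hs; apply/allP => m mp.
  have jacX i : jac_mon (U_(i) *+ s + m)%MM.
    have /jacobianP := hs _ (expX_max_ideal_pow K s i).
    by rewrite mulrC mpolyXn all_msuppMX => /allP; apply.
  move: (jacX 0) (jacX 1).
  rewrite /jac_mon /sat_mon !mnmDE !mulmnE !mnm1E /= !mul0n !mul1n !add0n.
  lia.
move=> hp; exists (2 * k).-1 => h /max_ideal_powP hh; apply/jacobianP.
apply: (all_msuppM _ hh hp) => m1 m2.
by rewrite mdeg3E /sat_mon /jac_mon !mnmDE; lia.
Qed.

(** If f = g^2 h then g divides every partial derivative of f.  The leading
    monomial of g therefore divides both x^(k-1) y^k and z^(2k-1), so it is 1;
    as the monomial order refines the degree, g is a nonzero constant. *)
Lemma reduced_conic : reduced_plane_curve (2 * k) f.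
Proof.
split.
- by rewrite muln_gt0 /= ltnW.
- apply/eqP => f0; have := partialE 2%:R; rewrite f0 mderiv0 => /esym/eqP.
  by rewrite -msupp_eq0 msuppMCX ?partial_coef_neq0.
- by rewrite conicE rpredD // dhomogX /= mdeg_xyz; lia.
move=> g h fE.
have dvd i : (mlead g <= partial_mon i)%MM.
  apply: (mlead_dvd_monomial (q := (g^`M(i) *+ 2) * h + g * h^`M(i))
            (partial_coef_neq0 i)).
  by rewrite -partialE fE expr2 !mderivM; ring.
have lead0 : mlead g = 0%MM.
  apply/mnmP => i; rewrite mnm0E; apply/eqP; rewrite -leqn0.
  move: (mnm_lepP (dvd 0)) (mnm_lepP (dvd 2%:R)) => d0 d2.
  move: i; apply: ord3P.
  - by apply: leq_trans (d2 0) _; rewrite /partial_mon xyzE.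
  - by apply: leq_trans (d2 1) _; rewrite /partial_mon xyzE.
  - by apply: leq_trans (d0 2%:R) _; rewrite /partial_mon xyzE.
have g0 : g != 0.
  apply/eqP => g0; have := partialE 0; rewrite fE g0 expr2 mul0r mul0r mderiv0.
  by move/esym/eqP; rewrite -msupp_eq0 msuppMCX ?partial_coef_neq0.
have /msize_poly1P[c c0 ->] : msize g == 1%N by rewrite -mlead_deg // lead0 mdeg0.
by apply: rmorph_unit; rewrite unitfE.
Qed.

(** A monomial of (u, Z) outside [J] is a multiple of u but not of ux, uy or Z,
    so it is u z^i with i < 2k-1, and its degree determines i. *)
Lemma gap_mon m :
  sat_mon m -> ~~ jac_mon m ->
  m = xyz k.-1 k.-1 (mdeg m - 2 * k.-1)%N /\
  (2 * k.-1 <= mdeg m < 2 * k.-1 + (2 * k).-1)%N.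
Proof.
rewrite mdeg3E /sat_mon /jac_mon => h1 h2; split; last by lia.
by apply/mnmP; apply: ord3P; rewrite !xyzE; lia.
Qed.

(** In degree j the class of u z^(j-2(k-1)) spans N(f)_j when
    2(k-1) <= j < 2(k-1) + 2k-1, and N(f)_j is 0 otherwise. *)
Lemma nearly_free_conic : nearly_free (2 * k) f.
Proof.
split; first exact: reduced_conic.
  exists u; split; first by apply/saturationP; rewrite msuppX /= /sat_mon !xyzE !leqnn.
  move/jacobianP; rewrite msuppX /= /jac_mon !xyzE; lia.
move=> j; case: (boolP (2 * k.-1 <= j < 2 * k.-1 + (2 * k).-1)%N) => hj; last first.
  exists 0%N => //; exists (fun=> 0); split=> [[] // | p /saturationP hp /dhomogP hd].
  exists 0; split=> [|c _]; last by apply/rowP; case.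
  rewrite big_ord0 subr0; apply/jacobianP/allP => m mp.
  apply: contraNT hj => /(gap_mon (allP hp _ mp))[_].
  by rewrite (hd _ mp).
pose w := xyz k.-1 k.-1 (j - 2 * k.-1).
have wI : sat_mon w by rewrite /sat_mon !xyzE !leqnn.
have wJ : ~~ jac_mon w by rewrite /jac_mon !xyzE; lia.
exists 1%N => //; exists (fun=> 'X_[w]); split.
  move=> _; split; first by apply/saturationP; rewrite msuppX /= wI.
  by rewrite dhomogX /= mdeg_xyz; lia.
move=> p /saturationP /allP hp /dhomogP hd.
have coefE (c : 'rV[K]_1) m : (p - \sum_(i < 1) c 0 i *: 'X_[w])@_m =
    p@_m - c 0 0 * (w == m)%:R.
  by rewrite big_ord1 mcoeffB mcoeffZ mcoeffX.
exists (const_mx p@_w); split.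
  apply/jacobianP/allP => m; rewrite mcoeff_msupp coefE mxE.
  have [<-|wm] := eqVneq w m; first by rewrite mulr1 subrr eqxx.
  rewrite mulr0 subr0 -mcoeff_msupp => mp.
  apply: contraNT wm => /(gap_mon (hp _ mp))[mE _].
  have dm : mdeg m = j by exact: hd.
  by rewrite mE dm.
move=> c /jacobianP /allP hc; apply/rowP => i; rewrite ord1 mxE.
apply/eqP; rewrite -subr_eq0; apply: contraNT wJ => cw; apply: hc.
by rewrite mcoeff_msupp coefE eqxx mulr1.
Qed.

(** * The resolution of the Milnor algebra *)

Definition row3 (a b c : {mpoly K[3]}) : 'rV_3 := \row_j [:: a; b; c]`_j.

Lemma row3P (v : 'rV[{mpoly K[3]}]_3) : exists a b c, v = row3 a b c.
Proof.
exists (v 0 0), (v 0 1), (v 0 2%:R).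
by apply/rowP; apply: ord3P; rewrite mxE.
Qed.

Lemma row3_inj a b c a' b' c' :
  row3 a b c = row3 a' b' c' <-> [/\ a = a', b = b' & c = c'].
Proof.
split=> [/rowP h | [-> -> ->]] //.
by move: (h 0) (h 1) (h 2%:R); rewrite !mxE.
Qed.

Definition gradient_mx : 'M[{mpoly K[3]}]_(3, 1) := \matrix_(i, j) f^`M(i).

(** The first row comes from the common factor u of the first two partial
    derivatives; the other rows are Koszul syzygies between one of these and the
    third, with the common scalar k removed. *)
Definition syzygy_mx : 'M[{mpoly K[3]}]_3 :=
  \matrix_(i, j) (nth [::]
    [:: [:: x; - y; 0]; [:: 2%:R * Z; 0; - (u * y)]; [:: 0; 2%:R * Z; - (u * x)]]
    i)`_j.

Definition second_syzygy_mx : 'M[{mpoly K[3]}]_(1, 3) := row3 (2%:R * Z) (- x) y.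

Lemma gradientE : [/\ f^`M(0) = k%:R * (u * y), f^`M(1) = k%:R * (u * x) &
  f^`M(2%:R) = k%:R * (2%:R * Z)].
Proof.
have kE : k = k.-1.+1 by lia.
rewrite !partialE /partial_coef /partial_mon /= -!mpolyXD !xyzD !addn0 addn1 -kE.
by rewrite -!mul_mpolyC !mpolyC_nat natrM mulrA [2%:R * _]mulrC.
Qed.

Lemma row3_mul a b c n (M : 'M[{mpoly K[3]}]_(3, n)) j :
  (row3 a b c *m M) 0 j = a * M 0 j + b * M 1 j + c * M 2%:R j.
Proof.
rewrite mxE !big_ord_recl big_ord0 !mxE addr0 addrA /=.
by congr (_ * M _ _ + _ * M _ _ + _ * M _ _); apply: val_inj.
Qed.

Lemma mul_gradient a b c : (row3 a b c *m gradient_mx) 0 0 =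
  k%:R * ((a * y + b * x) * u + c * (2%:R * Z)).
Proof.
by rewrite row3_mul !mxE; case: gradientE => -> -> ->; ring.
Qed.

Lemma mul_syzygy t p q : row3 t p q *m syzygy_mx =
  row3 (t * x + p * (2%:R * Z)) (- (t * y) + q * (2%:R * Z))
       (- (p * (u * y) + q * (u * x))).
Proof.
by apply/rowP; apply: ord3P; rewrite row3_mul !mxE /=; ring.
Qed.

Lemma mul_second_syzygy t : t *m second_syzygy_mx =
  row3 (t 0 0 * (2%:R * Z)) (- (t 0 0 * x)) (t 0 0 * y).
Proof.
by apply/rowP; apply: ord3P; rewrite mxE big_ord1 !mxE /=; ring.
Qed.

Lemma natr_mpoly_neq0 n : n%:R != 0 :> K -> n%:R != 0 :> {mpoly K[3]}.
Proof. by rewrite -mpolyC_nat mpolyC_eq0. Qed.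

(** Let (a, b, c) be a syzygy.  From (ay + bx) u = - 2cZ and the coprimality of u
    and Z one gets t with ay + bx = tZ and - 2c = tu.  As tZ lies in the prime
    ideal (x, y), so does t, say t = c1 y + c2 x; then
    (a - c1 Z) y = - (b - c2 Z) x, and the coprimality of x and y gives the
    coefficient of (x, -y, 0).  The coefficients c1 and c2 are halved because the
    Koszul syzygies are written with 2Z. *)
Lemma gradient_exact (v : 'rV[{mpoly K[3]}]_3) :
  v *m gradient_mx = 0 <-> exists w, v = w *m syzygy_mx.
Proof.
have [a [b [c ->]]] := row3P v; split; last first.
  case=> w; have [t [p [q ->]]] := row3P w; rewrite mul_syzygy => /row3_inj[-> -> ->].
  by apply/rowP => j; rewrite ord1 mul_gradient mxE; ring.
move/rowP/(_ 0); rewrite mul_gradient mxE => /eqP.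
rewrite mulf_eq0 (negPf (natr_mpoly_neq0 k_neq0)) /= addr_eq0 => /eqP syz.
have [||t [tE cE]] := @coprime_monomial_syzygy K 3 (xyz k.-1 k.-1 0)
    (xyz 0 0 (2 * k).-1) (a * y + b * x) (- (c * 2%:R)).
- by apply: ord3P; rewrite !xyzE ?orbT.
- by rewrite syz; ring.
(* t lies in (x, y) because Z involves neither x nor y. *)
have [c1 [c2 t_xy]] : exists c1 c2, t = c1 * y + c2 * x.
  pose g (i : 'I_2) : {mpoly K[3]} := if i == 0 then y else x.
  have [|_ []] := @ideal_gen_monomialP _ _ _ g (fun=> 1)
      (fun i => if i == 0 then xyz 0 1 0 else xyz 1 0 0) t _ (fun=> oner_neq0 K).
  - by move=> i; rewrite /g scale1r; case: ifP.
  - have : all (fun m : 'X_{1..3} => (0 < m 0%R) || (0 < m 1%R))%N (msupp (t * Z)).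
      rewrite -tE; apply: all_msuppD; rewrite all_msuppMX; apply/allP => m _;
      by rewrite !mnmDE !xyzE ?orbT.
    rewrite all_msuppMX; apply: sub_all => m; rewrite !mnmDE !xyzE !add0n.
    case/orP=> m0; apply/existsP; [exists 1 | exists 0];
    by rewrite /= xyz_le m0 ?andbT.
  by move=> h ->; exists (h ord0), (h (lift ord0 ord0)); rewrite big_ord_recl big_ord1.
have [||s [sa sb]] := @coprime_monomial_syzygy K 3 (xyz 0 1 0) (xyz 1 0 0)
    (a - c1 * Z) (- (b - c2 * Z)).
- by apply: ord3P; rewrite !xyzE ?orbT.
- apply/eqP; rewrite -subr_eq0; apply/eqP.
  transitivity ((a * y + b * x) - (c1 * y + c2 * x) * Z); first by ring.
  by rewrite tE -t_xy subrr.
pose h : {mpoly K[3]} := (2%:R^-1)%:MP.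
have h2 : h * 2%:R = 1.
  by rewrite -mpolyC_nat -mpolyCM mulVf ?two_neq0 // mpolyC1.
exists (row3 s (h * c1) (h * c2)); rewrite mul_syzygy; apply/row3_inj; split.
- by rewrite -[a](subrK (c1 * Z)) sa; ring: h2.
- by rewrite -[b](subrK (c2 * Z)) -[b - _]opprK sb; ring: h2.
transitivity (- (h * (t * u))); last by rewrite t_xy; ring.
by rewrite -cE mulrN opprK mulrCA h2 mulr1.
Qed.

(** The first two coordinates of a relation (t, p, q) read tx = - 2pZ and
    ty = 2qZ.  Coprimality of x and Z makes t a multiple of Z, and then p and q
    are determined by cancelling 2Z. *)
Lemma syzygy_exact (v : 'rV[{mpoly K[3]}]_3) :
  v *m syzygy_mx = 0 <-> exists w, v = w *m second_syzygy_mx.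
Proof.
have two0 := natr_mpoly_neq0 two_neq0.
have Z0 : Z != 0 by rewrite -msupp_eq0 msuppX.
have [t [p [q ->]]] := row3P v; rewrite mul_syzygy.
have -> : 0 = row3 0 0 0 by apply/rowP; apply: ord3P; rewrite !mxE.
split; last first.
  case=> w; rewrite mul_second_syzygy => /row3_inj[-> -> ->].
  by apply/row3_inj; split; ring.
move=> /row3_inj[/eqP tp /eqP tq _].
move: tp tq; rewrite addr_eq0 => /eqP tp; rewrite addrC subr_eq0 => /eqP tq.
have [||s [tE pE]] := @coprime_monomial_syzygy K 3 (xyz 1 0 0)
    (xyz 0 0 (2 * k).-1) t (- (2%:R * p)).
- by apply: ord3P; rewrite !xyzE ?orbT.
- by rewrite tp; ring.
pose h : {mpoly K[3]} := (2%:R^-1)%:MP.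
have h2 : 2%:R * h = 1.
  by rewrite -mpolyC_nat -mpolyCM mulfV ?two_neq0 // mpolyC1.
exists (const_mx (h * s)); rewrite mul_second_syzygy mxE; apply/row3_inj; split.
- by rewrite tE; ring: h2.
- by rewrite -[p]mul1r -h2 -[RHS]mulN1r -[h * s * x]mulrA -pE; ring.
apply: (mulIf Z0); apply: (mulfI two0).
transitivity (q * (2%:R * Z)); first by ring.
by rewrite tq tE; ring: h2.
Qed.

Lemma second_syzygy_inj (t : 'rV[{mpoly K[3]}]_1) :
  t *m second_syzygy_mx = 0 -> t = 0.
Proof.
have y0 : y != 0 by rewrite -msupp_eq0 msuppX.
rewrite mul_second_syzygy => /rowP/(_ 2%:R); rewrite !mxE /= => /eqP.
rewrite mulf_eq0 (negPf y0) orbF => /eqP t0.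
by apply/rowP => j; rewrite ord1 t0 mxE.
Qed.

Local Notation shifts :=
  (nearly_free_shifts (2 * k)%:Z 1 (2 * k%:Z - 1) (2 * k%:Z - 1) 1).

Definition conic_resolution (i : nat) :
    'M[{mpoly K[3]}]_(size (shifts i.+1), size (shifts i)) :=
  match i with
  | 0 => gradient_mx
  | 1 => syzygy_mx
  | 2 => second_syzygy_mx
  | _ => 0
  end.

(** The twists strictly increase along the resolution, which makes any graded
    map between these modules minimal. *)
Lemma shifts_lt i (p : 'I_(size (shifts i.+1))) (q : 'I_(size (shifts i))) :
  0 < (shifts i.+1)`_p - (shifts i)`_q.
Proof.
case: i p q => [|[|[|i]]] p q; last by case: p.
- by move: p q => [[|[|[|//]]] ?] [[|//] ?] /=; lia.
- by move: p q => [[|[|[|//]]] ?] [[|[|[|//]]] ?] /=; lia.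
- by move: p q => [[|//] ?] [[|[|[|//]]] ?] /=; lia.
Qed.

Lemma partial_homog i : f^`M(i) \is (2 * k).-1.-homog.
Proof.
rewrite partialE dhomogZ // dhomogX /partial_mon; move: i.
by apply: ord3P; rewrite /= mdeg_xyz; lia.
Qed.

Lemma conic_resolution_graded i : graded_map (conic_resolution i).
Proof.
have hom (n : nat) (a : int) (g : {mpoly K[3]}) :
    g \is n.-homog -> a = n%:Z -> zhomog a g by move=> hg ->.
have homN (n : nat) (g : {mpoly K[3]}) : g \is n.-homog -> - g \is n.-homog.
  by rewrite rpredN.
have hx : x \is 1.-homog by rewrite dhomogX /= mdeg_xyz.
have hy : y \is 1.-homog by rewrite dhomogX /= mdeg_xyz.
have hZ : 2%:R * Z \is (2 * k).-1.-homog.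
  by rewrite mulr_natl rpredMn // dhomogX /= mdeg_xyz.
have hux : u * x \is (2 * k).-1.-homog.
  by rewrite -mpolyXD xyzD dhomogX /= mdeg_xyz; lia.
have huy : u * y \is (2 * k).-1.-homog.
  by rewrite -mpolyXD xyzD dhomogX /= mdeg_xyz; lia.
case: i => [|[|[|i]]] p q; last by case: p.
- rewrite mxE; apply: (hom (2 * k).-1 _ _ (partial_homog p)).
  by move: p q => [[|[|[|//]]] ?] [[|//] ?] /=; lia.
- rewrite mxE; move: p q => [[|[|[|//]]] ?] [[|[|[|//]]] ?] /=;
    first [ exact: zhomog0 | apply: hom hx _; lia | apply: hom (homN _ _ hy) _; lia
          | apply: hom hZ _; lia | apply: hom (homN _ _ huy) _; lia
          | apply: hom (homN _ _ hux) _; lia ].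
- rewrite mxE; move: p q => [[|//] ?] [[|[|[|//]]] ?] /=;
    first [ apply: hom hZ _; lia | apply: hom (homN _ _ hx) _; lia
          | apply: hom hy _; lia ].
Qed.

Lemma conic_resolution_minimal_free :
  minimal_graded_free_resolution J conic_resolution (1%:M : 'M_1).
Proof.
split.
- exact: conic_resolution_graded.
- move=> p q; rewrite mxE; move: p q => [[|//] ?] [[|//] ?] /=.
  exact: dhomog1.
- move=> p; exists (const_mx p); rewrite mulmx1 mxE subrr.
  by exists (fun=> 0); rewrite big1 // => i _; rewrite mul0r.
- move=> v; rewrite mulmx1; split.
    case=> a va; exists (\row_i a i); apply/rowP => j; rewrite ord1 va mxE.
    by apply: eq_bigr => i _; rewrite !mxE.
  case=> w ->; exists (w 0); rewrite mxE.
  by apply: eq_bigr => i _; rewrite mxE.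
- case=> [|[|[|i]]] v.
  + exact: gradient_exact.
  + exact: syzygy_exact.
  + split=> [/second_syzygy_inj-> | [w ->]]; first by exists 0; rewrite mulmx0.
    by rewrite mulmx0 mul0mx.
  + by split=> _; [exists 0; apply/rowP; case | apply: mulmx0].
- move=> i p q; apply: zhomog_max_ideal (shifts_lt p q) _.
  exact: conic_resolution_graded.
Qed.

Lemma has_exponents_conic : has_exponents (2 * k) f 1 (2 * k%:Z - 1).
Proof.
exists (2 * k%:Z - 1), 1; split; [lia | lia | by [] | lia |].
by exists conic_resolution, 1%:M; apply: conic_resolution_minimal_free.
Qed.

End Conics.

Theorem proposition3p1 (R : realType) (k : nat) (hk : (2 <= k)%N) :
  nearly_free (2 * k) (conic_arrangement R[i] k) /\
  has_exponents (2 * k) (conic_arrangement R[i] k) 1 (2 * k%:Z - 1).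
Proof.
have ck : (2 * k)%:R != 0 :> R[i].
  by rewrite pnatr_eq0; lia.
by split; [exact: nearly_free_conic | exact: has_exponents_conic].
Qed.
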